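(* Let $I,J\subseteq\mathbb{R}$ be intervals with $(0,1)\subset J$, and let $h:J\to[0,\infty)$ be a function with $h\neq 0$ and $h\in L[0,1]$. Let $f:I\to\mathbb{R}$ be differentiable on the interior $I^{\circ}$ of $I$, let $a,b\in I^{\circ}$ with $a<b$, suppose $f'\in L[a,b]$, and let $\alpha,\lambda\in[0,1]$, $q>1$ and $\frac1p+\frac1q=1$. If $|f'|^{q}$ is $h$-convex on $[a,b]$, then $$\left|\lambda\left(\alpha f(a)+(1-\alpha)f(b)\right)+(1-\lambda)f(\alpha a+(1-\alpha)b)-\frac{1}{b-a}\int_a^b f(x)\,dx\right|$$ $$\le(b-a)\left(\frac{1}{p+1}\right)^{\frac1p}\left(\int_0^1h(t)\,dt\right)^{\frac1q}\cdot\begin{cases}\varepsilon_1^{\frac1p}C^{\frac1q}+\varepsilon_3^{\frac1p}D^{\frac1q}, & \alpha\lambda\le 1-\alpha\le 1-\lambda(1-\alpha),\\ \varepsilon_1^{\frac1p}C^{\frac1q}+\varepsilon_4^{\frac1p}D^{\frac1q}, & \alpha\lambda\le 1-\lambda(1-\alpha)\le 1-\alpha,\\ \varepsilon_2^{\frac1p}C^{\frac1q}+\varepsilon_3^{\frac1p}D^{\frac1q}, & 1-\alpha\le\alpha\lambda\le 1-\lambda(1-\alpha),\end{cases}$$ where $$C=(1-\alpha)\left[|f'((1-\alpha)b+\alpha a)|^q+|f'(a)|^q\right],\qquad D=\alpha\left[|f'((1-\alpha)b+\alpha a)|^q+|f'(b)|^q\right],$$ $$\varepsilon_1=(\alpha\lambda)^{p+1}+(1-\alpha-\alpha\lambda)^{p+1},\qquad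 \varepsilon_2=(\alpha\lambda)^{p+1}-(\alpha\lambda-1+\alpha)^{p+1},$$ $$\varepsilon_3=[\lambda(1-\alpha)]^{p+1}+[\alpha-\lambda(1-\alpha)]^{p+1},\qquad \varepsilon_4=[\lambda(1-\alpha)]^{p+1}-[\lambda(1-\alpha)-\alpha]^{p+1}.$$
   Context: A function $g$ on an interval $K$ is called $h$-convex on $K$ if $g$ is non-negative and for all $x,y\in K$ and $t\in(0,1)$ one has $g(tx+(1-t)y)\le h(t)g(x)+h(1-t)g(y)$. $L[c,d]$ denotes the (Lebesgue) integrable functions on $[c,d]$. Each $\varepsilon_i$ is only used in cases where the bases of its powers are non-negative. *)

(* Defs.v *)
From HB Require Import structures.
From mathcomp Require Import all_boot all_order all_algebra.
From mathcomp Require Import all_classical all_reals all_analysis.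
Import Order.TTheory GRing.Theory Num.Theory.
Import numFieldNormedType.Exports.

Set Implicit Arguments.
Unset Strict Implicit.
Unset Printing Implicit Defensive.

Local Open Scope classical_set_scope.
Local Open Scope ring_scope.

(* [h] stands for a function defined on a set containing the open interval
   (0, 1): only the values of [h] on (0, 1) are used. *)
Definition h_convex (R : realType) (h : R -> R) (K : set R) (g : R -> R) : Prop :=
  (forall x, K x -> 0 <= g x) /\
  (forall x y t, K x -> K y -> 0 < t < 1 ->
    g (t * x + (1 - t) * y) <= h t * g x + h (1 - t) * g y).

(* The class L[c, d].  The measure is the completed one because the library's
   [lebesgue_measure] lives on the Borel sigma-algebra, so that integrability
   with respect to it would also demand Borel measurability.  Endpoints are
   null sets: the values of [g] at [c] and [d] are irrelevant, so [g] may be a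
   function which is only meaningful on the open interval (c, d). *)
Definition L1_on (R : realType) (c d : R) (g : R -> R) : Prop :=
  (@completed_lebesgue_measure R).-integrable `[c, d] (EFin \o g).

Definition Lint (R : realType) (c d : R) (g : R -> R) : R :=
  \int[@completed_lebesgue_measure R]_(x in `[c, d]) g x.

(* Main.v *)
(* Each half of the error is reduced to [0, 1]: for phi differentiable,
   (1 - k) phi(1) + k phi(0) - int_0^1 phi is the increment over [0, 1] of
   (x - k) phi(x) - int_0^x phi, whose derivative is (x - k) phi'(x); it is
   bounded by int_0^1 |x - k| |phi'(x)| dx, to which Hoelder's inequality and
   the Hermite-Hadamard inequality for |phi'|^q apply.

   The derivative is not assumed continuous, so the bound of an increment by
   the integral of the absolute value of the derivative needs an argument.  By
   Baire's theorem phi' is bounded on some subinterval, and h-convexity of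
   |phi'|^q propagates this to local boundedness on (0, 1).  The bound then
   follows by dominated convergence of difference quotients on compact
   subintervals, and by continuity up to the endpoints. *)
Require Import Defs.
From HB Require Import structures.
From mathcomp Require Import all_boot all_order all_algebra.
From mathcomp Require Import all_classical all_reals all_analysis.
From mathcomp Require Import measurable_realfun.
From mathcomp Require Import ring lra.
Import Order.TTheory GRing.Theory Num.Theory.
Import numFieldNormedType.Exports.

Set Implicit Arguments.
Unset Strict Implicit.
Unset Printing Implicit Defensive.

Local Open Scope classical_set_scope.
Local Open Scope ring_scope.

(** * Integrals against the completed measure, and the reflection [x -> 1 - x] *)

Section completed_measure.
Context {R : realType}.
Local Notation mu := (@lebesgue_measure R).
Local Notation cmu := (@completed_lebesgue_measure R).
Local Notation cR := (caratheodory_type (wlength (@idfun R))^*%mu).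

Lemma measurable_completed (A : set R) : measurable A -> measurable (A : set cR).
Proof. by move=> mA; apply: sub_caratheodory. Qed.

Lemma measurable_id_completed :
  measurable_fun [set: cR] (idfun : cR -> measurableTypeR R).
Proof. by move=> _ Y mY; rewrite setTI; exact: measurable_completed. Qed.

(** The identity, from the completed sigma-algebra to the Borel one, pushes [cmu] forward to [mu],
    so this is a change of variables. *)
Lemma ge0_integral_completed (D : set R) (f : R -> \bar R) :
  measurable D -> measurable_fun D f -> (forall x, D x -> 0 <= f x)%E ->
  (\int[cmu]_(x in D) f x = \int[mu]_(x in D) f x)%E.
Proof.
move=> mD mf f0.
have f0' : {in D, forall y, 0 <= f y}%E by move=> x /set_mem; exact: f0.
rewrite -(@ge0_integral_pushforward _ _ cR (measurableTypeR R) R idfun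
  measurable_id_completed cmu D f mD mf f0').
by apply: eq_measure_integral; first exact: measurable_id_completed.
Qed.

Lemma integral_completed (D : set R) (f : R -> \bar R) :
  measurable D -> measurable_fun D f ->
  (\int[cmu]_(x in D) f x = \int[mu]_(x in D) f x)%E.
Proof.
move=> mD mf; rewrite [LHS]integralE [RHS]integralE.
rewrite !ge0_integral_completed//.
- exact: measurable_funeneg.
- exact: measurable_funepos.
Qed.

Lemma lebesgue_measure_onem (A : set R) : measurable A ->
  pushforward mu ((fun x : R => 1 - x) : _ -> measurableTypeR R) A = mu A.
Proof.
move=> mA; apply/esym/lebesgue_measure_unique => //=.
  exact: measurable_funB.
move=> mf _ [[a b]] _ <-; rewrite /pushforward.
(* By uniqueness of Lebesgue measure only half-open intervals matter; reflection moves the closed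
   end but keeps the length. *)
have -> : (fun x : R => 1 - x) @^-1` `]a, b] = `[1 - b, 1 - a[%classic :> set R.
  apply/seteqP; split => x /=; rewrite !in_itv/=; lra.
rewrite !lebesgue_measure_itv/= !lte_fin ltrD2l ltrN2.
by case: ifPn => // _; rewrite -!EFinD; congr EFin; lra.
Qed.

(** A completed-measurable set is a Borel set together with a subset of a Borel null set, and
    reflection preserves both kinds. *)
Lemma measurable_onem_completed :
  measurable_fun [set: cR] ((fun x : R => 1 - x) : cR -> cR).
Proof.
move=> _ Y; rewrite setTI /= -completed_caratheodory_measurable.
rewrite g_sigma_completed_algebra_genE => -[/= A mA [N [B [mB B0 NB]] <-]].
exists ((fun x : R => 1 - x) @^-1` A).
  by rewrite -(setTI (_ @^-1` _)); exact: measurable_funB.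
exists ((fun x : R => 1 - x) @^-1` N) => //.
exists ((fun x : R => 1 - x) @^-1` B); split; last by move=> x; exact: NB.
  by rewrite -(setTI (_ @^-1` _)); exact: measurable_funB.
by rewrite -B0; exact: lebesgue_measure_onem.
Qed.

(** Both measures are values of one outer measure: monotonicity gives one inequality, subadditivity
    the other. *)
Lemma completed_lebesgue_measureU_null (A N B : set R) :
  mu B = 0%E -> N `<=` B -> cmu (A `|` N) = mu A.
Proof.
move=> B0 NB; apply/eqP; rewrite eq_le; apply/andP; split; last first.
  by apply: (@le_outer_measure _ _ (wlength (@idfun R))^*%mu) => x Ax; left.
apply: le_trans (outer_measureU2 (wlength (@idfun R))^*%mu A N) _.
rewrite -[leRHS]adde0 leeD2l// -B0.
exact: (@le_outer_measure _ _ (wlength (@idfun R))^*%mu).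
Qed.

Lemma completed_lebesgue_measure_onem (A : set R) : measurable (A : set cR) ->
  pushforward cmu ((fun x : R => 1 - x) : cR -> cR) A = cmu A.
Proof.
rewrite /= -completed_caratheodory_measurable.
rewrite g_sigma_completed_algebra_genE => -[/= A' mA [N [B [mB B0 NB]] <-]].
rewrite /pushforward preimage_setU.
rewrite (completed_lebesgue_measureU_null _ B0 NB).
rewrite (@completed_lebesgue_measureU_null _ _ ((fun x : R => 1 - x) @^-1` B)).
- exact: lebesgue_measure_onem.
- by rewrite -B0; exact: lebesgue_measure_onem.
- by move=> x; exact: NB.
Qed.

(** This treats the term [h (1 - t)] of h-convexity. The function is only completed-measurable, so
    the reflection has to act on the completed sigma-algebra. *)
Lemma ge0_integral_onem_completed (h : R -> \bar R) :
  measurable_fun (`]0, 1[ : set cR) (h : cR -> \bar R) ->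
  (forall x : R, 0 < x < 1 -> (0 <= h x)%E) ->
  (\int[cmu]_(x in `]0%R, 1%R[) h (1 - x)%R = \int[cmu]_(x in `]0%R, 1%R[) h x)%E.
Proof.
move=> mh h0.
have m01 : measurable (`]0, 1[ : set cR) by exact: measurable_completed.
have h0' : {in `]0, 1[%classic : set R, forall y, (0 <= h y)%E}.
  by move=> x /set_mem; rewrite /= in_itv => /h0.
have := @ge0_integral_pushforward _ _ cR cR R (fun x : R => 1 - x)
  measurable_onem_completed cmu `]0%R, 1%R[%classic h m01 mh h0'.
have -> : (fun x : R => 1 - x) @^-1` `]0, 1[ = `]0, 1[%classic :> set R.
  by apply/seteqP; split => x /=; rewrite !in_itv/=; lra.
move=> <-; apply: eq_measure_integral; first exact: measurable_onem_completed.
move=> mf A mA _; exact: completed_lebesgue_measure_onem mA.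
Qed.
End completed_measure.

(** * Increments of a differentiable function and integrals of its derivative *)

Section ftc.
Context {R : realType}.
Local Notation mu := (@lebesgue_measure R).
Implicit Types (f g : R -> R) (a b c d : R).

Lemma continuous_antiderivative f a b : continuous f ->
  exists F, forall x, a < x < b -> is_derive x 1 F (f x).
Proof.
move=> cf; exists (fun x => \int[mu]_(t in `[a, x]) f t) => x /andP[ax xb].
have fi : mu.-integrable `[a, b] (EFin \o f).
  apply: continuous_compact_integrable; first exact: segment_compact.
  exact: continuous_subspaceT.
have [dF F'] := continuous_FTC1_closed xb fi ax (cf x).
apply: DeriveDef; first exact: dF.
rewrite -derive1E; exact: F'.
Qed.

(** Differentiability on an open interval around [[c, d]] supplies the one-sided limits of [F] at
    both ends. *)
Lemma continuous_FTC2_oo f F a b c d : continuous f ->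
  (forall x, a < x < b -> is_derive x 1 F (f x)) ->
  a < c -> c < d -> d < b ->
  (\int[mu]_(x in `[c, d]) (f x)%:E = (F d - F c)%:E)%E.
Proof.
move=> cf dF ac cd db; rewrite EFinB.
have cF x : a < x < b -> {for x, continuous F}.
  by move=> /dF d1; apply/differentiable_continuous/derivable1_diffP.
apply: continuous_FTC2 => //.
- exact: continuous_subspaceT.
- split.
  + by move=> x /[!in_itv]/= /andP[? ?]; have [] := dF x _; [lra|].
  + by apply: cvg_at_right_filter; apply: cF; lra.
  + by apply: cvg_at_left_filter; apply: cF; lra.
- move=> x /[!in_itv]/= /andP[? ?].
  by have d1 := dF x ltac:(lra); rewrite derive1E derive_val.
Qed.

Lemma cvg_difference_quotient f (x : R) (e : R^nat) : derivable f x 1 ->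
  (forall n, e n != 0) -> e n @[n --> \oo] --> 0 ->
  (f (x + e n) - f x) / e n @[n --> \oo] --> derive1 f x.
Proof.
move=> df e0 cve; rewrite derive1E.
have /cvgr_dnbhsP/(_ e (conj e0 cve)) := df.
rewrite (_ : (fun n => _) = (fun n => (f (x + e n) - f x) / e n)) => //.
by apply/funext => n /=; rewrite [e n *: 1]mulr1 [LHS]mulrC (addrC x).
Qed.

Lemma cvg_cst_divSn (e : R) : e / n.+1%:R @[n --> \oo] --> 0.
Proof.
rewrite -(mulr0 e); apply: cvgMr; exact: cvg_harmonic.
Qed.

(** The derivative is a pointwise limit of continuous difference quotients. *)
Lemma measurable_fun_derive1 f a b : continuous f ->
  (forall x, a < x < b -> derivable f x 1) ->
  measurable_fun (`]a, b[ : set R) (derive1 f).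
Proof.
move=> cf df.
pose D (n : nat) x := (f (x + 1 / n.+1%:R) - f x) / (1 / n.+1%:R).
refine (@measurable_fun_cvg _ R R `]a, b[%classic D (derive1 f) _ _).
- move=> n; apply: measurable_funTS; apply: continuous_measurable_fun => x.
  apply: cvgMl; apply: cvgB; last exact: cf.
  apply: continuous_comp; last exact: cf.
  by apply: cvgD; [exact: cvg_id|exact: cvg_cst].
- move=> x; rewrite /= in_itv/= => xab.
  apply: cvg_difference_quotient; first exact: df.
  + by move=> n; rewrite mul1r invr_eq0 pnatr_eq0.
  + exact: cvg_cst_divSn.
Qed.

(** With [F] an antiderivative of [f], the integral over [[c, d]] of a difference quotient of [f] is
    the difference of those of [F] at [d] and [c], and tends to [f d - f c]. The mean value theorem
    bounds the quotients by [M], so dominated convergence identifies the limit with the integral of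
    the derivative. The bound is asked beyond [d] because the quotients look to the right. *)
Lemma le_increment_integral_bounded f a b c d (M : R) : continuous f ->
  (forall x, a < x < b -> derivable f x 1) ->
  a < c -> c < d -> d < b ->
  (forall x, c <= x < b -> `|derive1 f x| <= M) ->
  (`|f d - f c|%:E <= \int[mu]_(x in `[c, d]) `|derive1 f x|%:E)%E.
Proof.
move=> cf df ac cd db leM.
have [F dF] := continuous_antiderivative (a - 1) (b + 1) cf.
(* The steps stay below [b - d], so that [x + e n < b] for all [x] in [[c, d]]. *)
pose e (n : nat) := ((b - d) / 2) / n.+1%:R.
have e_gt0 n : 0 < e n by rewrite !divr_gt0// subr_gt0.
have e_lt n : e n < b - d.
  have n1 : 1 <= n.+1%:R :> R by rewrite ler1n.
  have n0 : 0 < n.+1%:R :> R by rewrite ltr0n.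
  by rewrite ltr_pdivrMr//; nra.
have cve : e n @[n --> \oo] --> 0 by exact: cvg_cst_divSn.
have e_neq0 n : e n != 0 by rewrite gt_eqF.
pose D (n : nat) x := (f (x + e n) - f x) / e n.
have cshift n : continuous (fun x => f (x + e n)).
  move=> x; apply: continuous_comp; last exact: cf.
  by apply: cvgD; [exact: cvg_id|exact: cvg_cst].
have cD n : continuous (D n).
  by move=> x; apply: cvgMl; apply: cvgB; [exact: cshift|exact: cf].
have int_D n : (\int[mu]_(x in `[c, d]) (D n x)%:E =
   ((F (d + e n) - F d) / e n - (F (c + e n) - F c) / e n)%:E)%E.
  (* The difference quotient of [F] is an antiderivative of the one of [f]. *)
  pose G x := (F (x + e n) - F x) / e n.
  have dG x : a < x < b - e n -> is_derive x 1 G (D n x).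
    move=> /andP[ax xb]; have := e_gt0 n; have := e_lt n => ? ?.
    have dF1 : is_derive (x + e n) 1 F (f (x + e n)) by apply: dF; lra.
    have dF2 : is_derive x 1 F (f x) by apply: dF; lra.
    have dF3 : is_derive x 1 (fun x => F (x + e n)) (f (x + e n)).
      have dx : is_derive x 1 (fun x => x + e n) 1.
        by apply: is_derive_eq; rewrite addr0.
      by have := @is_derive1_comp _ F (fun x => x + e n) x _ _ dF1 dx; rewrite mulr1.
    have := is_deriveZ (e n)^-1 (is_deriveB dF3 dF2).
    rewrite [X in is_derive _ _ X _](_ : _ = G); last first.
      by apply/funext => y; rewrite /G mulrC.
    by rewrite [X in is_derive _ _ _ X](_ : _ = D n x)// /D mulrC.
  have db' : d < b - e n by have := e_lt n; lra.
  rewrite (continuous_FTC2_oo (cD n) dG ac cd db') /G; congr EFin; ring.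
have cvg_int : (\int[mu]_(x in `[c, d]) (D n x)%:E)%E @[n --> \oo] --> (f d - f c)%:E.
  under eq_fun do rewrite int_D.
  apply: cvg_EFin; first exact: nearW.
  apply: cvgB.
  - have dFd : is_derive d 1 F (f d) by apply: dF; lra.
    rewrite -(@derive_val _ _ _ _ _ _ _ dFd) -derive1E.
    by apply: cvg_difference_quotient.
  - have dFd : is_derive c 1 F (f c) by apply: dF; lra.
    rewrite -(@derive_val _ _ _ _ _ _ _ dFd) -derive1E.
    by apply: cvg_difference_quotient.
have mdf : measurable_fun (`[c, d] : set R) (derive1 f).
  apply: measurable_funS (measurable_fun_derive1 cf df) => //.
  by move=> x /=; rewrite !in_itv/=; lra.
have leD x n : c <= x <= d -> `|D n x| <= M.
  move=> /andP[cx xd]; have := e_gt0 n; have := e_lt n => ? ?.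
  have [|||z zx Dz] := @MVT R f (derive1 f) x (x + e n).
  - by rewrite ltrDl.
  - move=> y; rewrite in_itv/= => yx; rewrite derive1E.
    by apply: derivableP; apply: df; lra.
  - exact: continuous_subspaceT.
  rewrite /D Dz [x + e n]addrC addrK mulfK//; apply: leM.
  by move: zx; rewrite in_itv/=; lra.
have icst : mu.-integrable `[c, d] (cst M%:E).
  apply: continuous_compact_integrable; first exact: segment_compact.
  by move=> x; exact: cvg_cst.
have [||||_ _ dct] := @dominated_convergence _ _ R mu `[c, d]%classic (measurable_itv _)
  (fun n x => (D n x)%:E) (fun x => (derive1 f x)%:E) (cst M%:E) _ _ _ icst.
- move=> n; apply/measurable_EFinP; apply: measurable_funTS.
  exact: continuous_measurable_fun.
- exact/measurable_EFinP.
- apply: aeW => x; rewrite /= in_itv/= => xcd; apply: cvg_EFin; first exact: nearW.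
  by apply: cvg_difference_quotient => //; apply: df; lra.
- by apply: aeW => x n; rewrite /= in_itv/= lee_fin => /leD.
have int_df : (\int[mu]_(x in `[c, d]) (derive1 f x)%:E)%E = (f d - f c)%:E.
  exact: cvg_unique dct cvg_int.
have mdf' : measurable_fun `[c, d]%classic (EFin \o derive1 f).
  exact/measurable_EFinP.
have := le_abse_integral mu (measurable_itv `[c, d]) mdf'.
by rewrite /= int_df.
Qed.

(** The bound holds for all points near x and all large [M] jointly; compactness makes one [M] serve
    for the whole of [K]. *)
Lemma compact_locally_bounded (g : R -> R) (K : set R) : compact K ->
  (forall x, K x -> exists M, \forall y \near x, `|g y| <= M) ->
  exists M, forall x, K x -> `|g x| <= M.
Proof.
move=> /compact_near_coveringP cK gK.
suff : \forall M \near +oo, K `<=` [set x | `|g x| <= M].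
  by case=> M [_ KM]; exists (M + 1) => x; apply: KM; rewrite ltrDl.
apply: (cK _ _ (fun M x => `|g x| <= M)) => x /gK[M gM].
exists ([set y | `|g y| <= M], [set N | M <= N]).
  by split => //=; exact: nbhs_pinfty_ge (num_real _).
by case=> y N /= [gy MN]; exact: le_trans gy MN.
Qed.

Lemma le_increment_integral f a b : a < b -> continuous f ->
  (forall x, a < x < b -> derivable f x 1) ->
  (forall x, a < x < b -> exists M, \forall y \near x, `|derive1 f y| <= M) ->
  (`|f b - f a|%:E <= \int[mu]_(x in `]a, b[) `|derive1 f x|%:E)%E.
Proof.
move=> ab cf df bf.
have mdf : measurable_fun (`]a, b[ : set R) (fun x => `|derive1 f x|%:E).
  by apply/measurable_EFinP/measurableT_comp => //; exact: measurable_fun_derive1.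
have step (e : R) : 0 < e < (b - a) / 2 ->
  (`|f (b - e) - f (a + e)|%:E <= \int[mu]_(x in `]a, b[) `|derive1 f x|%:E)%E.
  move=> /andP[e0 eb].
  (* The bound must reach past the right end [b - e] of the interval of integration, hence
     [b - e / 2]. *)
  have [|M leM] := @compact_locally_bounded (derive1 f) `[a + e, b - e / 2]
      (@segment_compact _ _ _).
    by move=> x; rewrite /= in_itv/= => ?; apply: bf; lra.
  apply: (@le_trans _ _ (\int[mu]_(x in `[(a + e)%R, (b - e)%R]) `|derive1 f x|%:E)%E).
    apply: (@le_increment_integral_bounded f a (b - e / 2) _ _ M) => //; try lra.
      by move=> x xab; apply: df; lra.
    by move=> x xab; apply: leM; rewrite /= in_itv/=; lra.
  apply: ge0_subset_integral => //.
  by move=> x /=; rewrite !in_itv/=; lra.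
have cvg_e : `|f (b - e) - f (a + e)|%:E @[e --> 0^'+] --> `|f b - f a|%:E.
  apply: cvg_EFin; first exact: nearW.
  apply: cvg_norm; apply: cvgB.
  - apply: cvg_at_right_filter.
    rewrite -[X in _ --> f X]subr0; apply: (@continuous_comp _ _ _ (fun e => b - e) f).
      by apply: cvgB; [exact: cvg_cst|exact: cvg_id].
    exact: cf.
  - apply: cvg_at_right_filter.
    rewrite -[X in _ --> f X]addr0; apply: (@continuous_comp _ _ _ (fun e => a + e) f).
      by apply: cvgD; [exact: cvg_cst|exact: cvg_id].
    exact: cf.
apply: cvge_to_le cvg_e _.
near=> e; apply: step; apply/andP; split => //.
by near: e; apply: nbhs_right_lt; lra.
Unshelve. all: end_near. Qed.
End ftc.

(** * Boundedness of a derivative on some subinterval *)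

Section baire.
Context {R : realType}.
Implicit Types (f g : R -> R) (a b c d : R).

(** Within distance [r] of x the difference quotient is within 1 of the derivative; farther away the
    global bound gives [2 * B / r]. The constant is a natural number so that countably many sets
    cover in the Baire argument. *)
Lemma derivable_lipschitz_at f (x B : R) : derivable f x 1 ->
  (forall y, `|f y| <= B) ->
  exists k : nat, forall y, `|f y - f x| <= k%:R * `|y - x|.
Proof.
move=> df fB.
have B0 : 0 <= B by apply: le_trans (fB x).
pose D h := h^-1 *: (f (h *: 1 + x) - f x).
have : D h @[h --> 0^'] --> derive1 f x by rewrite derive1E; exact: df.
move=> /cvgrPdist_lt/(_ 1 ltr01)[/= r r0 Dr].
pose K := Num.max (`|derive1 f x| + 1) (2 * B / r).
have K0 : 0 <= K by rewrite /K le_max addr_ge0.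
exists (Num.trunc K).+1 => y.
apply: (@le_trans _ _ (K * `|y - x|)); last first.
  by rewrite ler_wpM2r// ltW// truncnS_gt.
have [->|yx] := eqVneq y x; first by rewrite !subrr normr0 mulr0.
have yx0 : 0 < `|y - x| by rewrite normr_gt0 subr_eq0.
have [yr|yr] := ltP `|y - x| r.
  have yx' : y - x != 0 by rewrite subr_eq0.
  have := Dr (y - x); rewrite /= sub0r normrN => /(_ yr yx').
  rewrite /D [(y - x) *: 1]mulr1 subrK => D1.
  have : `|(y - x)^-1 * (f y - f x)| <= K.
    rewrite /K le_max; apply/orP; left.
    rewrite -lerBlDl; apply: le_trans (ltW D1).
    by rewrite distrC; exact: lerB_dist.
  by rewrite normrM normfV mulrC ler_pdivrMr.
have fyx : `|f y - f x| <= 2 * B.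
  by apply: le_trans (ler_normB _ _) _; rewrite mulr_natl mulr2n lerD.
apply: le_trans fyx _; apply: (@le_trans _ _ (2 * B / r * `|y - x|)).
  by rewrite -mulrA ler_peMr ?mulr_ge0// mulrC ler_pdivlMr// mul1r.
by rewrite ler_wpM2r// /K le_max lexx orbT.
Qed.

Lemma derive1_le_lipschitz_at f (x k : R) : derivable f x 1 ->
  (forall y, `|f y - f x| <= k * `|y - x|) -> `|derive1 f x| <= k.
Proof.
move=> df fk.
have h0 n : n.+1%:R^-1 != 0 :> R by rewrite invr_eq0 pnatr_eq0.
have /cvg_norm := cvg_difference_quotient df h0 cvg_harmonic.
move=> /cvgr_to_le; apply; apply: nearW => n /=.
rewrite normrM normfV ler_pdivrMr ?normr_gt0//.
by apply: le_trans (fk _) _; rewrite (addrC x) addrK.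
Qed.

(* The sets where f is Lipschitz with constant k are closed and cover
   the interval, so one of them has nonempty interior. *)
Lemma derivable_bounded_subinterval f a b (B : R) : a < b -> continuous f ->
  (forall x, `|f x| <= B) -> (forall x, a < x < b -> derivable f x 1) ->
  exists c d k, [/\ a < c, c < d, d < b &
    forall x, c < x < d -> `|derive1 f x| <= k].
Proof.
move=> ab cf fB df.
(* A closed interval inside [(a, b)] makes the sets [A k] closed in the line while [f] remains
   differentiable on them. *)
pose a' := a + (b - a) / 3; pose b' := b - (b - a) / 3.
have aa' : a < a' by rewrite /a'; lra.
have b'b : b' < b by rewrite /b'; lra.
have a'b' : a' < b' by rewrite /a' /b'; lra.
pose A (k : nat) : set R := `[a', b'] `&`
  \bigcap_y [set x | `|f y - f x| <= k%:R * `|y - x|].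
have closedA k : closed (A k).
  apply: closedI; first exact: itv_closed.
  apply: closed_bigI => y _.
  pose g x := `|f y - f x| - k%:R * `|y - x|.
  have -> : [set x | `|f y - f x| <= k%:R * `|y - x|] = g @^-1` [set z | z <= 0].
    by apply/seteqP; split => x /=; rewrite /g subr_le0.
  apply: closed_comp; last exact: closed_le.
  move=> x _; apply: cvgB.
    by apply: cvg_norm; apply: cvgB; [exact: cvg_cst|exact: cf].
  by apply: cvgMr; apply: cvg_norm; apply: cvgB; [exact: cvg_cst|exact: cvg_id].
have [k ndA] : exists k, ~ dense (~` A k).
  apply: contrapT => /forallNP ndA.
  have dA k : dense (~` A k) by apply: contrapT; exact: ndA.
  (* If all complements were dense, some point of []a', b'[] would lie in no [A k], against the
     Lipschitz bound at that point. *)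
  have [|||x [xab xA]] := @Baire R R^o (fun k => ~` A k) _ `]a', b'[%classic.
  - by move=> k; split=> //; exact/closed_openC.
  - exists ((a' + b') / 2); rewrite /= in_itv/=; lra.
  - exact: itv_open.
  have xab' : a' < x < b' by move: xab; rewrite /= in_itv.
  have dfx : derivable f x 1 by apply: df; lra.
  have [k xk] := derivable_lipschitz_at dfx fB.
  by apply: (xA k Logic.I); split; [rewrite /= in_itv/=; lra|move=> y _; exact: xk].
(* A nonempty open set missing the complement lies in [A k], and so does a ball around each of its
   points. *)
move: ndA => /existsNP[ O] /not_implyP[[x Ox]] /not_implyP[oO OA].
have OAk y : O y -> A k y.
  by move=> Oy; apply: contrapT => nA; apply: OA; exists y.
have /nbhs_ballP[r /= r0 xr] := open_nbhs_nbhs (conj oO Ox).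
have Ay y : `|x - y| < r -> A k y by move=> xy; exact/OAk/xr.
have Ay' y : x - r < y < x + r -> A k y.
  by move=> xy; apply: Ay; rewrite ltr_norml; lra.
(* Membership of [x - r / 2] and [x + r / 2] in [A k] places them in [[a', b']], hence strictly
   inside [(a, b)]. *)
have [] := Ay' (x - r / 2); first by lra.
rewrite /= in_itv/= => c1 _.
have [] := Ay' (x + r / 2); first by lra.
rewrite /= in_itv/= => d1 _.
exists (x - r / 2), (x + r / 2), k%:R; split; try lra.
move=> y xy; apply: derive1_le_lipschitz_at; first by apply: df; lra.
have [] := Ay' y; first by lra.
by move=> _ yk z; exact: (yk z Logic.I).
Qed.

End baire.

(** * Propagation of bounds by h-convexity *)

Section h_convex.
Context {R : realType}.
Implicit Types (f g h : R -> R) (a b c d : R).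

(** With [p] and [s] fixed, the points [s * p + (1 - s) * z] with [z] in []c, d[] fill a ball of
    radius [(1 - s) * ((d - c) / 2)], on which h-convexity gives one bound. *)
Lemma h_convex_bounded_near h g a b c d k p s : h_convex h `[a, b] g ->
  (forall t, 0 < t < 1 -> 0 <= h t) ->
  a < c -> c < d -> d < b -> (forall x, c < x < d -> g x <= k) ->
  a <= p <= b -> 0 < s < 1 ->
  \forall y \near s * p + (1 - s) * ((c + d) / 2),
    g y <= h s * g p + h (1 - s) * k.
Proof.
move=> [g0 gh] h0 ac cd db gk pab s01.
have r0 : 0 < (1 - s) * ((d - c) / 2) by rewrite mulr_gt0; lra.
apply/nbhs_ballP; exists ((1 - s) * ((d - c) / 2)) => //= y.
rewrite /ball/= ltr_norml => yr.
have s1 : 1 - s != 0 by lra.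
pose z := (y - s * p) / (1 - s).
have yz : y = s * p + (1 - s) * z by rewrite /z; field.
have zcd : c < z < d.
  have s0 : 0 < 1 - s by lra.
  by rewrite -(ltr_pM2l s0) -[X in _ && X](ltr_pM2l s0); lra.
have abz : `[a, b]%classic z by rewrite /= in_itv/=; lra.
have abp : `[a, b]%classic p by rewrite /= in_itv.
rewrite yz; apply: le_trans (gh _ _ _ abp abz s01) _.
by rewrite lerD2l ler_wpM2l ?h0 ?gk//; lra.
Qed.

Lemma h_convex_locally_bounded h g a b c d k : h_convex h `[a, b] g ->
  (forall t, 0 < t < 1 -> 0 <= h t) ->
  a < c -> c < d -> d < b -> (forall x, c < x < d -> g x <= k) ->
  forall x, a < x < b -> exists M, \forall y \near x, g y <= M.
Proof.
move=> gh h0 ac cd db gk x xab.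
pose m := (c + d) / 2.
have cm : c < m by rewrite /m; lra.
have md : m < d by rewrite /m; lra.
(* A point other than the midpoint [m] lies strictly between [m] and one of the ends [a], [b], which
   serves as [p]; [s] is its barycentric weight. *)
suff [mx|[p [s [pab s01 ->]]]] : m = x \/
    exists p s, [/\ a <= p <= b, 0 < s < 1 & x = s * p + (1 - s) * m].
- exists k; near=> y; apply: gk.
  have : y \in `]c, d[ by near: y; apply: near_in_itvoo; rewrite in_itv/= -mx; lra.
  by rewrite in_itv.
- exists (h s * g p + h (1 - s) * k).
  exact: (h_convex_bounded_near gh h0 ac cd db gk pab s01).
have [xm|mx|->] := ltgtP x m; last by left.
- right; exists a, ((m - x) / (m - a)).
  have ma : 0 < m - a by lra.
  split; [lra| |by field; lra].
  by rewrite divr_gt0 ?ltr_pdivrMr; lra.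
- right; exists b, ((x - m) / (b - m)).
  have ma : 0 < b - m by lra.
  split; [lra| |by field; lra].
  by rewrite divr_gt0 ?ltr_pdivrMr; lra.
Unshelve. all: end_near. Qed.
End h_convex.

(** * Transfer from a compact interval to functions on the whole line *)

Section clamp.
Context {R : realType}.
Local Notation mu := (@lebesgue_measure R).
Implicit Types (f g h : R -> R) (a b c d : R).

(** Precomposing with the projection onto [[a, b]] extends [f] by constants. This provides the
    global continuity and the global bound which the preceding lemmas ask for. *)
Lemma bounded_continuous_extension f a b : a <= b ->
  (forall x, a <= x <= b -> {for x, continuous f}) ->
  exists g B, [/\ continuous g, forall x, `|g x| <= B &
    forall x, a <= x <= b -> g x = f x].
Proof.
move=> ab cf; pose clamp x := Num.max a (Num.min b x).
have clampP x : a <= clamp x <= b.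
  by rewrite /clamp le_max lexx/= ge_max ab ge_min lexx.
have cclamp : continuous clamp.
  move=> x; apply: (@continuous_max _ _ (cst a)); first exact: cvg_cst.
  by apply: (@continuous_min _ _ (cst b)); [exact: cvg_cst|exact: cvg_id].
have [|B fB] := @compact_locally_bounded R f `[a, b] (@segment_compact _ _ _).
  move=> x; rewrite /= in_itv/= => /cf /cvgrPdist_lt/(_ 1 ltr01) fx.
  exists (`|f x| + 1); near=> y.
  have : `|f x - f y| < 1 by near: y.
  by have := lerB_dist (f y) (f x); rewrite (distrC (f y)); lra.
exists (f \o clamp), B; split.
- by move=> x; apply: continuous_comp; [exact: cclamp|exact/cf/clampP].
- by move=> x; apply: fB; rewrite /= in_itv/=; exact: clampP.
- by move=> x /andP[ax xb]; rewrite /= /clamp min_r// max_r.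
Unshelve. all: end_near. Qed.

Lemma eq_itv_derivable f g a b x : (forall y, a < y < b -> f y = g y) ->
  a < x < b -> derivable f x 1 -> derivable g x 1.
Proof.
move=> fg xab; apply: near_eq_derivable; near=> y; apply: fg.
have : y \in `]a, b[ by near: y; apply: near_in_itvoo; rewrite in_itv.
by rewrite in_itv.
Unshelve. all: end_near. Qed.

Lemma eq_itv_derive1 f g a b x : (forall y, a < y < b -> f y = g y) ->
  a < x < b -> derive1 f x = derive1 g x.
Proof.
move=> fg xab; rewrite !derive1E; apply: near_eq_derive; near=> y; apply: fg.
have : y \in `]a, b[ by near: y; apply: near_in_itvoo; rewrite in_itv.
by rewrite in_itv.
Unshelve. all: end_near. Qed.

Lemma derivable_continuous f x : derivable f x 1 -> {for x, continuous f}.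
Proof. by move=> df; apply/differentiable_continuous/derivable1_diffP. Qed.

Lemma derivable_extension f a b : a <= b ->
  (forall x, a <= x <= b -> derivable f x 1) ->
  exists g B, [/\ continuous g, forall x, `|g x| <= B,
    forall x, a <= x <= b -> g x = f x,
    forall x, a < x < b -> derivable g x 1 &
    forall x, a < x < b -> derive1 g x = derive1 f x].
Proof.
move=> ab df.
have [|g [B [cg gB gf]]] := @bounded_continuous_extension f a b ab.
  by move=> x /df; exact: derivable_continuous.
have fg y : a < y < b -> f y = g y by move=> yab; rewrite gf//; lra.
exists g, B; split => // x xab.
- by apply: (eq_itv_derivable fg) => //; apply: df; lra.
- by rewrite (eq_itv_derive1 fg).
Qed.

Lemma measurable_fun_derive1_itv f a b : a <= b ->
  (forall x, a <= x <= b -> derivable f x 1) ->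
  measurable_fun (`]a, b[ : set R) (derive1 f).
Proof.
move=> ab df; have [g [B [cg _ _ dg dgf]]] := derivable_extension ab df.
apply: (eq_measurable_fun (derive1 g)).
  by move=> x /set_mem; rewrite /= in_itv/=; exact: dgf.
exact: measurable_fun_derive1.
Qed.

Lemma le_increment_integral_itv f a b : a < b ->
  (forall x, a <= x <= b -> derivable f x 1) ->
  (forall x, a < x < b -> exists M, \forall y \near x, `|derive1 f y| <= M) ->
  (`|f b - f a|%:E <= \int[mu]_(x in `]a, b[) `|derive1 f x|%:E)%E.
Proof.
move=> ab df bf.
have [g [B [cg _ gf dg dgf]]] := derivable_extension (ltW ab) df.
rewrite -(gf b) ?lexx ?(ltW ab)// -(gf a) ?lexx ?(ltW ab)//.
have -> : (\int[mu]_(x in `]a, b[) `|derive1 f x|%:E)%E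
    = (\int[mu]_(x in `]a, b[) `|derive1 g x|%:E)%E.
  by apply: eq_integral => x /set_mem; rewrite /= in_itv/= => ?; rewrite dgf.
apply: le_increment_integral => // x xab; have [M fM] := bf x xab.
exists M; near=> y; rewrite dgf; first by near: y.
have : y \in `]a, b[ by near: y; apply: near_in_itvoo; rewrite in_itv.
by rewrite in_itv.
Unshelve. all: end_near. Qed.

Lemma h_convex_derive1_locally_bounded h f a b q : a < b -> 0 < q ->
  (forall t, 0 < t < 1 -> 0 <= h t) ->
  (forall x, a <= x <= b -> derivable f x 1) ->
  h_convex h `[a, b] (fun x => `|derive1 f x| `^ q) ->
  forall x, a < x < b -> exists M, \forall y \near x, `|derive1 f y| <= M.
Proof.
move=> ab q0 h0 df hf x xab.
have [g [B [cg gB gf dg dgf]]] := derivable_extension (ltW ab) df.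
have [c [d [k [ac cd db gk]]]] := derivable_bounded_subinterval ab cg gB dg.
(* The Baire bound is raised to the power [q], propagated by h-convexity, and turned back by a
   [q]-th root. *)
have fk y : c < y < d -> `|derive1 f y| `^ q <= k `^ q.
  move=> ycd; have yk := gk y ycd.
  rewrite -dgf; last by lra.
  by apply: (ge0_ler_powR (ltW q0)) => //; rewrite nnegrE//; apply: le_trans yk.
have [M fM] := h_convex_locally_bounded hf h0 ac cd db fk xab.
exists (M `^ q^-1); near=> y.
have yM : `|derive1 f y| `^ q <= M by near: y.
have : (`|derive1 f y| `^ q) `^ q^-1 <= M `^ q^-1.
  apply: ge0_ler_powR => //; rewrite ?nnegrE ?powR_ge0 ?invr_ge0 ?(ltW q0)//.
  by apply: le_trans yM; exact: powR_ge0.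
by rewrite -powRrM mulfV ?gt_eqF// powRr1.
Unshelve. all: end_near. Qed.

End clamp.

(** * Hoelder's inequality on a measurable set *)

Section hoelder.
Context {R : realType}.
Local Notation mu := (@lebesgue_measure R).

Lemma hoelder_itv (D : set R) (f g : R -> R) (p q : R) : measurable D ->
  measurable_fun D f -> measurable_fun D g ->
  0 < p -> 0 < q -> p^-1 + q^-1 = 1 ->
  (\int[mu]_(x in D) `|f x * g x|%:E <=
   (\int[mu]_(x in D) (`|f x| `^ p)%:E) `^ p^-1 *
   (\int[mu]_(x in D) (`|g x| `^ q)%:E) `^ q^-1)%E.
Proof.
move=> mD mf mg p0 q0 pq.
have mfD := (measurable_restrictT _ mD).1 mf.
have mgD := (measurable_restrictT _ mD).1 mg.
have := hoelder mu mfD mgD p0 q0 pq.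
(* The norm of the extension by zero is an integral over [D], because [0] to a positive power is
   [0]. *)
have E (u : R -> R) (r : R) : 0 < r -> ('N[mu]_r%:E[EFin \o (u \_ D)] =
    (\int[mu]_(x in D) (`|u x| `^ r)%:E) `^ r^-1)%E.
  move=> r0; rewrite unlock [in RHS]integral_mkcond.
  congr ((integral _ _ _) `^ _)%E; apply/funext => x.
  rewrite /= !patchE; case: ifPn => //= _.
  by rewrite normr0 powR0// gt_eqF.
rewrite !E//; apply: le_trans.
rewrite Lnorm1 le_eqVlt; apply/orP; left; apply/eqP; rewrite [LHS]integral_mkcond.
apply: eq_integral => x _; rewrite /= !patchE; case: ifPn => //= _.
by rewrite mulr0 normr0.
Qed.
End hoelder.

(** * The right-hand Hermite-Hadamard inequality for h-convex functions *)

Section hermite_hadamard.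
Context {R : realType}.
Local Notation mu := (@lebesgue_measure R).
Local Notation cmu := (@completed_lebesgue_measure R).
Local Notation cR := (caratheodory_type (wlength (@idfun R))^*%mu).

Lemma integral_completed_itv_oo_cc (h : R -> R) : L1_on 0 1 h ->
  (\int[cmu]_(x in `]0%R, 1%R[) (h x)%:E = (Lint 0 1 h)%:E)%E.
Proof.
move=> hL.
have mN : measurable ([set 0; 1]%classic : set cR).
  by apply: measurable_completed; apply: measurableU; exact: measurable_set1.
have m01 : measurable (`[0, 1]%classic : set cR) by exact: measurable_completed.
have N0 : cmu [set 0; 1]%classic = 0%E.
  exact/(@countable_lebesgue_measure0 R)/finite_set_countable.
rewrite /Lint /Rintegral fineK; last exact: integral_fune_fin_num.
rewrite [RHS](negligible_integral mN m01 hL N0).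
suff -> : `]0, 1[%classic = `[0, 1]%classic `\` [set 0; 1] :> set R by [].
clear; apply/seteqP; split => x /=; rewrite !in_itv/=.
  by move=> x01; split; [lra|case=> ?; lra].
by move=> [/andP[x0 x1] /not_orP[/eqP n0 /eqP n1]]; rewrite !lt_neqAle eq_sym n0 n1 x0.
Qed.

(** Integrate [g t <= h t * g 1 + h (1 - t) * g 0]; by reflection both terms carry the same integral
    of [h]. *)
Lemma integral_h_convex_le (h g : R -> R) : h_convex h `[0, 1] g ->
  (forall t, 0 < t < 1 -> 0 <= h t) -> L1_on 0 1 h ->
  measurable_fun (`]0, 1[ : set R) g ->
  (\int[mu]_(x in `]0%R, 1%R[) (g x)%:E <= ((g 0 + g 1) * Lint 0 1 h)%:E)%E.
Proof.
move=> [g0 gh] h0 hL mg.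
have m01 : measurable (`]0, 1[%classic : set cR) by exact: measurable_completed.
have g_0 : 0 <= g 0 by apply: g0; rewrite /= in_itv/= lexx ler01.
have g_1 : 0 <= g 1 by apply: g0; rewrite /= in_itv/= lexx ler01.
have mEg : measurable_fun (`]0, 1[ : set R) (EFin \o g) by exact/measurable_EFinP.
have g0' x : 0 < x < 1 -> 0 <= g x by move=> x01; apply: g0; rewrite /= in_itv/=; lra.
have mh : measurable_fun (`]0, 1[%classic : set cR) (EFin \o h : cR -> \bar R).
  have /integrableP[mh _] := hL.
  apply: measurable_funS mh; first exact: measurable_completed.
  by move=> x /=; rewrite !in_itv/=; lra.
have mh1 : measurable_fun (`]0, 1[%classic : set cR)
    ((fun x => (h (1 - x))%:E) : cR -> \bar R).
  have im01 : [set 1 - x | x in `]0, 1[%classic : set R] `<=` `]0, 1[.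
    by move=> _ [x /= + <-]; rewrite !in_itv/=; lra.
  have m1 : measurable_fun (`]0, 1[%classic : set cR) ((fun x : R => 1 - x) : cR -> cR).
    by apply: measurable_funS measurable_onem_completed.
  exact: (@measurable_comp _ _ _ cR cR (\bar R) `]0, 1[%classic (EFin \o h)
    `]0, 1[%classic (fun x : R => 1 - x) m01 im01 mh m1).
have Eg0 x : `]0%R, 1%R[%classic x -> (0 <= (g x)%:E)%E.
  by rewrite /= in_itv/= lee_fin; exact: g0'.
(* The comparison takes place under the completed measure, for which [h] is measurable. *)
rewrite -(ge0_integral_completed (measurable_itv _) mEg Eg0).
apply: (@le_trans _ _ (\int[cmu]_(x in `]0%R, 1%R[)
    ((g 1)%:E * (h x)%:E + (g 0)%:E * (h (1 - x))%:E))%E).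
  have mr : measurable_fun (`]0, 1[%classic : set cR) (fun x : cR =>
      (g 1)%:E * (h x)%:E + (g 0)%:E * (h (1 - x))%:E)%E.
    by apply: emeasurable_funD; apply: measurable_funeM.
  apply: (ge0_le_integral cmu m01 Eg0 _ mr).
    by move=> _ Y mY; apply: measurable_completed; exact: mEg.
  move=> x; rewrite /= in_itv/= => x01; rewrite -!EFinM -EFinD lee_fin.
  have := gh 1 0 x; rewrite mulr1 mulr0 addr0 mulrC (mulrC (g 0)); apply => //.
  - by rewrite /= in_itv/= lexx ler01.
  - by rewrite /= in_itv/= lexx ler01.
have hE x : `]0%R, 1%R[%classic x -> (0 <= (h x)%:E)%E.
  by rewrite /= in_itv/= lee_fin; exact: h0.
have hE1 x : `]0%R, 1%R[%classic x -> (0 <= (h (1 - x))%:E)%E.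
  by rewrite /= in_itv/= => x01; rewrite lee_fin h0//; lra.
have gh0 x : `]0%R, 1%R[%classic x -> (0 <= (g 1)%:E * (h x)%:E)%E.
  by move=> x01; rewrite mule_ge0 ?hE ?lee_fin.
have gh1 x : `]0%R, 1%R[%classic x -> (0 <= (g 0)%:E * (h (1 - x))%:E)%E.
  by move=> x01; rewrite mule_ge0 ?hE1 ?lee_fin.
rewrite (ge0_integralD cmu m01 gh0 (measurable_funeM _ mh) gh1
  (measurable_funeM _ mh1)).
rewrite (ge0_integralZl_EFin cmu m01 hE mh g_1).
rewrite (ge0_integralZl_EFin cmu m01 hE1 mh1 g_0).
have -> := ge0_integral_onem_completed mh hE.
rewrite integral_completed_itv_oo_cc//.
by rewrite -!EFinM -EFinD lee_fin -mulrDl addrC.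
Qed.
End hermite_hadamard.

(** * The error estimate on the unit interval *)

Section weighted_endpoints.
Context {R : realType}.
Local Notation mu := (@lebesgue_measure R).

Lemma weighted_endpoints_h_convex (h f : R -> R) (k p q : R) :
  0 < p -> 0 < q -> p^-1 + q^-1 = 1 ->
  (forall t, 0 < t < 1 -> 0 <= h t) -> L1_on 0 1 h ->
  (forall x, 0 <= x <= 1 -> derivable f x 1) ->
  h_convex h `[0, 1] (fun x => `|derive1 f x| `^ q) ->
  (`|(1 - k) * f 1 + k * f 0 - \int[mu]_(x in `[0, 1]) f x|%:E <=
   (\int[mu]_(x in `]0%R, 1%R[) (`|x - k| `^ p)%:E) `^ p^-1 *
   (((`|derive1 f 0| `^ q + `|derive1 f 1| `^ q) * Lint 0 1 h) `^ q^-1)%:E)%E.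
Proof.
move=> p0 q0 pq h0 hL df hf.
have [g [B [cg _ gf _ _]]] := derivable_extension ler01 df.
(* The interval [(-1, 2)] makes 0 and 1 interior points. *)
have [F dF] := continuous_antiderivative (-1) 2 cg.
have dF01 (x : R) : 0 <= x <= 1 -> is_derive x 1 F (f x).
  by move=> x01; rewrite -gf//; apply: dF; lra.
have intf : \int[mu]_(x in `[0, 1]) f x = F 1 - F 0.
  have lt0 : -1 < 0 :> R by lra.
  have lt2 : 1 < 2 :> R by lra.
  have := continuous_FTC2_oo cg dF lt0 ltr01 lt2.
  move=> /(congr1 fine) /= <-; apply: eq_Rintegral => x.
  by rewrite inE/= in_itv/= => ?; rewrite gf.
(* The product rule produces a term [f x], which the derivative of [F] cancels. *)
pose G x := (x - k) * f x - F x.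
have dG (x : R) : 0 <= x <= 1 -> is_derive x 1 G ((x - k) * derive1 f x).
  move=> x01.
  have dfx : is_derive x 1 f (derive1 f x).
    by rewrite derive1E; apply: derivableP; exact: df.
  have dFx := dF01 x x01.
  have dx : is_derive x 1 (fun x => x - k) 1 by apply: is_derive_eq; rewrite subr0.
  have := is_deriveB (is_deriveM dx dfx) dFx.
  move=> H; apply: is_derive_eq H _.
  by rewrite [f x *: 1]mulr1 addrK.
have dG1 (x : R) : 0 <= x <= 1 -> derive1 G x = (x - k) * derive1 f x.
  by move=> /dG dGx; rewrite derive1E derive_val.
have -> : (1 - k) * f 1 + k * f 0 - \int[mu]_(x in `[0, 1]) f x = G 1 - G 0.
  by rewrite intf /G; ring.
have mf := measurable_fun_derive1_itv ler01 df.
have leG : (`|G 1 - G 0|%:E <=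
    \int[mu]_(x in `]0%R, 1%R[) `|(x - k) * derive1 f x|%:E)%E.
  have -> : (\int[mu]_(x in `]0%R, 1%R[) `|(x - k) * derive1 f x|%:E =
      \int[mu]_(x in `]0%R, 1%R[) `|derive1 G x|%:E)%E.
    by apply: eq_integral => x; rewrite inE/= in_itv/= => ?; rewrite dG1//; lra.
  apply: le_increment_integral_itv => //.
    by move=> x x01; have := dG x x01; case.
  move=> x x01.
  have [M fM] := h_convex_derive1_locally_bounded ltr01 q0 h0 df hf x01.
  (* On [(0, 1)] the kernel [y - k] is at most [1 + |k|] in absolute value. *)
  exists ((1 + `|k|) * M); near=> y.
  have : y \in `]0, 1[ by near: y; apply: near_in_itvoo; rewrite in_itv.
  rewrite in_itv/= => y01; rewrite dG1; last by lra.
  rewrite normrM ler_pM//; last by near: y.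
  by apply: le_trans (ler_normB _ _) _; rewrite lerD2r ger0_norm; lra.
apply: le_trans leG _.
have mk : measurable_fun (`]0, 1[ : set R) (fun x => x - k).
  by apply: measurable_funTS; exact: measurable_funB.
apply: le_trans (hoelder_itv (measurable_itv _) mk mf p0 q0 pq) _.
apply: lee_wpmul2l; first exact: poweR_ge0.
rewrite -poweR_EFin.
have leH : (\int[mu]_(x in `]0%R, 1%R[) (`|derive1 f x| `^ q)%:E <=
    ((`|derive1 f 0| `^ q + `|derive1 f 1| `^ q) * Lint 0 1 h)%:E)%E.
  apply: (integral_h_convex_le hf h0 hL).
  apply: (measurableT_comp (measurable_powR q)); exact: measurableT_comp.
have I0 : (0 <= \int[mu]_(x in `]0%R, 1%R[) (`|derive1 f x| `^ q)%:E)%E.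
  by apply: integral_ge0 => x _; rewrite lee_fin powR_ge0.
apply: gt0_ler_poweR => //.
- by rewrite invr_ge0 ltW.
- by rewrite in_itv/= I0 leey.
- by rewrite in_itv/= (le_trans I0 leH) leey.
Unshelve. all: end_near. Qed.
End weighted_endpoints.

(** * The integral of the power of the kernel *)

Section power_integral.
Context {R : realType}.
Local Notation mu := (@lebesgue_measure R).
Implicit Types (p k x : R).

Lemma normr_powR_cvg0 p : 0 < p -> `|x| `^ p @[x --> (0 : R)] --> 0.
Proof.
move=> p0; apply/cvgr0Pnorm_lt => e e0.
have d0 : 0 < e `^ p^-1 by rewrite powR_gt0.
exists (e `^ p^-1) => //= x; rewrite /ball_/= sub0r normrN => xd.
rewrite ger0_norm ?powR_ge0//.
have := gt0_ltr_powR p0 _ _ xd.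
rewrite -powRrM mulVf ?gt_eqF// powRr1 ?(ltW e0)//; apply.
- by rewrite nnegrE.
- by rewrite nnegrE ltW.
Qed.

Lemma continuous_normr_powR p : 0 < p -> continuous (fun x : R => `|x| `^ p).
Proof.
move=> p0 x; have [->|x0] := eqVneq x 0.
  by rewrite /continuous_at normr0 powR0 ?gt_eqF//; exact: normr_powR_cvg0.
apply: (@continuous_comp R R R (fun x : R => `|x|) (fun x => x `^ p)).
  exact: (@norm_continuous _ R).
apply: derivable_continuous; apply: derivable_powR.
by rewrite in_itv/= normr_gt0 x0.
Qed.

(** This is the odd extension of the power [x ^ (p + 1)]: the power rule for positive x, oddness for
    negative x, and at 0 the difference quotient is [|h| ^ p], which tends to 0. *)
Lemma is_derive_mul_normr_powR p x : 0 < p ->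
  is_derive x 1 (fun x => x * `|x| `^ p) ((p + 1) * `|x| `^ p).
Proof.
move=> p0; pose S x := x * `|x| `^ p.
have pos (u : R) : 0 < u -> is_derive u 1 S ((p + 1) * `|u| `^ p).
  move=> u0; have := is_derive1_powR (p + 1) u0.
  rewrite addrK gtr0_norm//; apply: near_eq_is_derive.
  near=> y; have y0 : 0 < y by near: y; exact: lt_nbhsr.
  have yn0 : y != 0 by rewrite gt_eqF.
  by rewrite /S gtr0_norm// powRD ?yn0 ?implybT// powRr1 ?(ltW y0)// mulrC.
have [x0|x0|x0] := ltgtP 0 x; first exact: pos.
- have Nx0 : 0 < - x by lra.
  have dN : is_derive x 1 (fun y : R => - y) (-1 : R) by apply: is_deriveN.
  have := is_deriveN (@is_derive1_comp _ S (fun y : R => - y) x _ _ (pos _ Nx0) dN).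
  rewrite mulrN1 opprK normrN.
  rewrite [X in is_derive _ _ X _](_ : _ = S)//.
  by apply/funext => y; rewrite /S !fctE /= normrN; ring.
- rewrite -x0 normr0 powR0 ?gt_eqF// mulr0.
  have cvS : h^-1 *: (S (h *: 1 + 0) - S 0) @[h --> (0:R)^'] --> 0.
    apply: (@cvg_trans _ (`|x| `^ p @[x --> 0^'])).
      apply: near_eq_cvg; near=> h.
      have h0 : h != 0 by near: h; exact: nbhs_dnbhs_neq.
      by rewrite addr0 [h *: 1]mulr1 /S mul0r subr0 /GRing.scale/= mulKf.
    by apply: cvg_trans (normr_powR_cvg0 p0); apply: cvg_app; exact: nbhs_dnbhs.
  by apply: DeriveDef; [apply/cvg_ex; exists 0|exact: cvg_lim].
Unshelve. all: end_near. Qed.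

(** The signed antiderivative gives one formula for every position of [k]; the distinction between k
    inside and outside [[0, 1]] is left to the final case analysis. *)
Lemma integral_normr_subr_powR k p : 0 < p ->
  (\int[mu]_(x in `]0%R, 1%R[) (`|x - k| `^ p)%:E =
   (((1 - k) * `|1 - k| `^ p + k * `|k| `^ p) / (p + 1))%:E)%E.
Proof.
move=> p0; pose F x := (p + 1)^-1 * ((x - k) * `|x - k| `^ p).
have cf : continuous (fun x => `|x - k| `^ p).
  move=> x; apply: (@continuous_comp _ _ _ (fun x => x - k) (fun x => `|x| `^ p)).
    by apply: cvgB; [exact: cvg_id|exact: cvg_cst].
  exact: continuous_normr_powR.
have dF (x : R) : -1 < x < 2 -> is_derive x 1 F (`|x - k| `^ p).
  move=> _; have dx : is_derive x 1 (fun x : R => x - k) 1.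
    by apply: is_derive_eq; rewrite subr0.
  have := is_deriveZ (p + 1)^-1 (@is_derive1_comp _ _ (fun x => x - k) x _ _
    (is_derive_mul_normr_powR (x - k) p0) dx).
  move=> H; apply: is_derive_eq H _.
  have p1 : p + 1 != 0 by rewrite gt_eqF// addr_gt0.
  by rewrite mulr1 /GRing.scale/= mulKf.
have lt0 : -1 < 0 :> R by lra.
have lt2 : 1 < 2 :> R by lra.
have mf : measurable_fun (`]0, 1[ : set R) (fun x => (`|x - k| `^ p)%:E).
  apply/measurable_EFinP; apply: measurable_funTS.
  exact: continuous_measurable_fun.
rewrite -(integral_itv_bndoo true false mf).
rewrite (continuous_FTC2_oo cf dF lt0 ltr01 lt2) /F sub0r normrN; congr EFin; ring.
Qed.
End power_integral.

(** * Rescaling from the unit interval to a segment from [u] to [v] *)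

Section segments.
Context {R : realType}.
Local Notation mu := (@lebesgue_measure R).
Implicit Types (f g h F : R -> R) (a b u v w m p q : R).

Lemma is_derive_segment f u v (s : R) (d : R) :
  is_derive (s * v + (1 - s) * u) 1 f d ->
  is_derive s 1 (fun s : R => f (s * v + (1 - s) * u)) ((v - u) * d).
Proof.
move=> df.
have ds : is_derive s 1 (fun s : R => s * v + (1 - s) * u) (v - u).
  have -> : (fun s => s * v + (1 - s) * u) = (fun s => (v - u) * s + u).
    by apply/funext => t; ring.
  have := is_deriveD (is_deriveZ (v - u) (is_derive_id s 1)) (is_derive_cst u s 1).
  by move=> H; apply: is_derive_eq H _; rewrite addr0 [(v - u) *: 1]mulr1.
have := @is_derive1_comp _ f _ s _ _ df ds.
by rewrite mulrC.
Qed.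

(** The factor [v - u] stays on the left, so the degenerate segment is included. For [s] in
    [(-1, 2)] the point on the line leaves [[a, b]] by at most [b - a], which explains the domain on
    which [F] is an antiderivative. *)
Lemma integral_segment g F a b u v : continuous g ->
  (forall x : R, a - (b - a) - 1 < x < b + (b - a) + 1 -> is_derive x 1 F (g x)) ->
  a <= u <= b -> a <= v <= b ->
  (v - u) * \int[mu]_(s in `[0, 1]) g (s * v + (1 - s) * u) = F v - F u.
Proof.
move=> cg dF uab vab.
have [->|uv] := eqVneq u v; first by rewrite !subrr mul0r.
have vu0 : v - u != 0 by rewrite subr_eq0 eq_sym.
pose G s := (v - u)^-1 * F (s * v + (1 - s) * u).
have cgs : continuous (fun s : R => g (s * v + (1 - s) * u)).
  move=> s; apply: (@continuous_comp R R R (fun s => s * v + (1 - s) * u) g);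
    last exact: cg.
  apply: cvgD; first by apply: cvgMl; exact: cvg_id.
  by apply: cvgMl; apply: cvgB; [exact: cvg_cst|exact: cvg_id].
have dG (s : R) : -1 < s < 2 -> is_derive s 1 G (g (s * v + (1 - s) * u)).
  move=> s12.
  have dFs : is_derive (s * v + (1 - s) * u) 1 F (g (s * v + (1 - s) * u)).
    by apply: dF; nra.
  have := is_deriveZ (v - u)^-1 (is_derive_segment dFs).
  by move=> H; apply: is_derive_eq H _; rewrite /GRing.scale/= mulKf.
have lt0 : -1 < 0 :> R by lra.
have lt2 : 1 < 2 :> R by lra.
rewrite /Rintegral (continuous_FTC2_oo cgs dG lt0 ltr01 lt2)/= /G.
rewrite -mulrBr mulVKf//; congr (F _ - F _); ring.
Qed.

Lemma h_convex_segment h g u v a b (k : R) : 0 <= k ->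
  a <= u <= b -> a <= v <= b -> h_convex h `[a, b] g ->
  h_convex h `[0, 1] (fun s => k * g (s * v + (1 - s) * u)).
Proof.
move=> k0 uab vab [g0 gh].
have sab s : `[0, 1]%classic s -> `[a, b]%classic (s * v + (1 - s) * u).
  by rewrite /= !in_itv/= => s01; nra.
split=> [s /sab sv|s r t /sab sv /sab rv t01]; first by rewrite mulr_ge0// g0.
rewrite [h t * _]mulrCA [h (1 - t) * _]mulrCA -mulrDr ler_wpM2l//.
apply: le_trans (gh _ _ _ sv rv t01).
by rewrite le_eqVlt; apply/orP; left; apply/eqP; congr g; ring.
Qed.

(** One half of the error: [L] is the full length, [w] the share of the segment in it, and the
    unit-interval estimate is applied with [k = m / w]. Multiplying through by [w] allows
    [w = 0]. *)
Lemma weighted_segment_h_convex h f a b u v w m (L p q : R) :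
  0 < p -> 0 < q -> p^-1 + q^-1 = 1 ->
  (forall t, 0 < t < 1 -> 0 <= h t) -> L1_on 0 1 h ->
  (forall x, a <= x <= b -> derivable f x 1) ->
  h_convex h `[a, b] (fun x => `|derive1 f x| `^ q) ->
  a <= u <= b -> a <= v <= b -> 0 <= w -> 0 <= L -> `|v - u| = w * L ->
  `|(w - m) * f v + m * f u
      - w * \int[mu]_(s in `[0, 1]) f (s * v + (1 - s) * u)| <=
  L * (1 / (p + 1)) `^ (1 / p) * Lint 0 1 h `^ (1 / q) *
  (((w - m) * `|w - m| `^ p + m * `|m| `^ p) `^ (1 / p) *
   (w * (`|derive1 f v| `^ q + `|derive1 f u| `^ q)) `^ (1 / q)).
Proof.
move=> p0 q0 pq h0 hL df hf uab vab; rewrite le_eqVlt => /predU1P[<- L0|w0 L0 vuw].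
  (* For [w = 0] the endpoints coincide and the left side vanishes. *)
  rewrite mul0r => /eqP; rewrite normr_eq0 subr_eq0 => /eqP ->.
  rewrite sub0r mulNr addNr mul0r subrr normr0.
  by rewrite !mulr_ge0 ?powR_ge0.
pose phi s := f (s * v + (1 - s) * u).
have sab s : 0 <= s <= 1 -> a <= s * v + (1 - s) * u <= b by nra.
have dphi (s : R) : 0 <= s <= 1 ->
    is_derive s 1 phi ((v - u) * derive1 f (s * v + (1 - s) * u)).
  move=> /sab/df dfs; apply: is_derive_segment.
  by rewrite derive1E; exact: derivableP.
have dphi1 (s : R) : 0 <= s <= 1 ->
    derive1 phi s = (v - u) * derive1 f (s * v + (1 - s) * u).
  by move=> /dphi ds; rewrite derive1E derive_val.
have hphi : h_convex h `[0, 1] (fun s => `|derive1 phi s| `^ q).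
  have E s : 0 <= s <= 1 -> `|derive1 phi s| `^ q =
     (w * L) `^ q * `|derive1 f (s * v + (1 - s) * u)| `^ q.
    move=> s01; rewrite dphi1// normrM vuw.
    by rewrite (powRM _ (mulr_ge0 (ltW w0) L0) (normr_ge0 _)).
  have [H0 H1] := h_convex_segment (powR_ge0 (w * L) q) uab vab hf.
  split=> [s s01|s r t s01 r01 t01]; first by rewrite powR_ge0.
  have := H1 _ _ _ s01 r01 t01; move: s01 r01; rewrite /= !in_itv/= => s01 r01 H.
  have sr01 : 0 <= t * s + (1 - t) * r <= 1 by clear -s01 r01 t01; nra.
  rewrite (E _ s01) (E _ r01) (E _ sr01); exact: H.
have dphiE (x : R) : 0 <= x <= 1 -> derivable phi x 1 by move=> /dphi; case.
have := weighted_endpoints_h_convex (m / w) p0 q0 pq h0 hL dphiE hphi.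
pose J := ((1 - m / w) * `|1 - m / w| `^ p + m / w * `|m / w| `^ p) / (p + 1).
have J0 : 0 <= J.
  rewrite -lee_fin -integral_normr_subr_powR//.
  by apply: integral_ge0 => x _; rewrite lee_fin powR_ge0.
rewrite integral_normr_subr_powR// -/J poweR_EFin -EFinM lee_fin.
rewrite !dphi1 ?lexx ?ler01// /phi !mul1r !mul0r subr0 subrr !mul0r !mul1r addr0 add0r.
move=> core.
have w_neq0 : w != 0 by rewrite gt_eqF.
have p1 : 0 < p + 1 by rewrite addr_gt0.
have -> : (w - m) * f v + m * f u
    - w * \int[mu]_(s in `[0, 1]) f (s * v + (1 - s) * u) =
  w * ((1 - m / w) * f v + m / w * f u
    - \int[mu]_(s in `[0, 1]) f (s * v + (1 - s) * u)) by field.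
rewrite normrM gtr0_norm//.
apply: le_trans (ler_wpM2l (ltW w0) core) _.
(* Homogeneity of degree [p + 1] in [w] and [m]. *)
have EJ : (w - m) * `|w - m| `^ p + m * `|m| `^ p = (w * w `^ p) * ((p + 1) * J).
  rewrite /J; have : m = w * (m / w) by field.
  move: (m / w) => k ->; have -> : w - w * k = w * (1 - k) by ring.
  rewrite !normrM (gtr0_norm w0) (powRM _ (ltW w0) (normr_ge0 _)).
  rewrite (powRM _ (ltW w0) (normr_ge0 _)); field.
  by rewrite gt_eqF.
have ww : 0 <= w * w `^ p by rewrite mulr_ge0 ?powR_ge0// ltW.
have pip : p * p^-1 = 1 by rewrite mulfV// gt_eqF.
have piq : q * q^-1 = 1 by rewrite mulfV// gt_eqF.
have H0 : 0 <= Lint 0 1 h.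
  rewrite -lee_fin -integral_completed_itv_oo_cc//.
  by apply: integral_ge0 => x; rewrite /= in_itv/= lee_fin; exact: h0.
set gu := `|derive1 f u| `^ q; set gv := `|derive1 f v| `^ q.
have gu0 : 0 <= gu by exact: powR_ge0.
have gv0 : 0 <= gv by exact: powR_ge0.
have wL : 0 <= w * L by rewrite mulr_ge0// ltW.
have -> : `|(v - u) * derive1 f u| `^ q + `|(v - u) * derive1 f v| `^ q
    = (w * L) `^ q * (gv + gu).
  rewrite !normrM vuw !(powRM _ wL (normr_ge0 _)) -/gu -/gv.
  by move: (_ `^ q) gu gv gu0 gv0 => A x y _ _; rewrite mulrDr addrC.
clearbody gu gv.
have gvu : 0 <= gv + gu by rewrite addr_ge0.
have pJ : 0 <= (p + 1) * J by rewrite mulr_ge0// ltW.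
clearbody J.
rewrite EJ (powRM _ ww pJ).
rewrite (powRM _ (ltW p1) J0).
rewrite (powRM _ (ltW w0) (powR_ge0 _ _)) -powRrM pip powRr1 ?(ltW w0)//.
rewrite (powRM _ (mulr_ge0 (powR_ge0 _ _) gvu) H0) (powRM _ (powR_ge0 _ _) gvu).
rewrite -powRrM piq powRr1// (powRM _ (ltW w0) gvu).
(* Conjugate exponents make the constants match: the powers of [p + 1] cancel, and those of [w]
   recombine to [w]. *)
have Ep : (p + 1)^-1 `^ p^-1 * (p + 1) `^ p^-1 = 1.
  by rewrite -powRM ?invr_ge0 ?(ltW p1)// mulVf ?gt_eqF// powR1.
have Ew : w `^ p^-1 * w `^ q^-1 = w.
  by rewrite -powRD ?pq ?powRr1 ?(ltW w0)// oner_eq0.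
rewrite le_eqVlt; apply/orP; left; apply/eqP.
set P1 := (p + 1)^-1 `^ p^-1 in Ep *; set P2 := (p + 1) `^ p^-1 in Ep *.
set W1 := w `^ p^-1 in Ew *; set W2 := w `^ q^-1 in Ew *.
move: (J `^ p^-1) (Lint 0 1 h `^ q^-1) ((gv + gu) `^ q^-1) => j H G.
clearbody P1 P2 W1 W2.
transitivity ((P1 * P2) * (W1 * W2) * (L * H * (w * j) * G)); last by ring.
rewrite Ep Ew; ring.
Qed.
End segments.

Lemma interior_itvcc (R : realType) (I : set R) (a b x : R) : is_interval I ->
  interior I a -> interior I b -> a <= x <= b -> interior I x.
Proof.
move=> hI ha hb xab.
have [Ia Ib] := (interior_subset ha, interior_subset hb).
move: xab; rewrite !le_eqVlt => /andP[/predU1P[<- //|ax] /predU1P[-> //|xb]].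
have : \near x, x \in `]a, b[ by apply: near_in_itvoo; rewrite in_itv/= ax xb.
apply: filterS => y; rewrite in_itv/= => /andP[ay yb].
by apply: (hI a b Ia Ib); rewrite !ltW.
Qed.

(** * Splitting at the intermediate point and assembling the total error *)

Section total_error.
Context {R : realType}.
Local Notation mu := (@lebesgue_measure R).

Lemma normr_powRS (x p : R) : 0 <= x -> 0 < p -> x * `|x| `^ p = x `^ (p + 1).
Proof.
move=> x0 p0; have p1 : 0 < p + 1 by rewrite addr_gt0.
by rewrite ger0_norm// -[in LHS](addrK 1 p) mulr_powRB1.
Qed.

(** Both segments run from an endpoint to [c]; the second goes backwards, and
    [c - b = - al * (b - a)] absorbs the sign. *)
Lemma Lint_segments (f : R -> R) (a b al : R) : a < b -> 0 <= al <= 1 ->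
  (forall x, a <= x <= b -> {for x, continuous f}) ->
  let c := al * a + (1 - al) * b in
  Lint a b f = (b - a) *
    ((1 - al) * \int[mu]_(s in `[0, 1]) f (s * c + (1 - s) * a)
     + al * \int[mu]_(s in `[0, 1]) f (s * c + (1 - s) * b)).
Proof.
move=> ab al01 cf c.
have [g [B [cg _ gf]]] := bounded_continuous_extension (ltW ab) cf.
have [F dF] := continuous_antiderivative (a - (b - a) - 1) (b + (b - a) + 1) cg.
have cab : a <= c <= b by rewrite /c; nra.
have -> : Lint a b f = F b - F a.
  rewrite /Lint /Rintegral.
  have -> : (\int[completed_lebesgue_measure]_(x in `[a, b]) (f x)%:E =
             \int[completed_lebesgue_measure]_(x in `[a, b]) (g x)%:E)%E.
    by apply: eq_integral => x; rewrite inE/= in_itv/= => xab; rewrite gf.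
  have mg : measurable_fun (`[a, b] : set R) (EFin \o g).
    apply/measurable_EFinP; apply: measurable_funTS.
    exact: continuous_measurable_fun.
  rewrite (integral_completed (measurable_itv _) mg).
  rewrite (continuous_FTC2_oo cg dF)//; lra.
have E u : a <= u <= b ->
    (c - u) * \int[mu]_(s in `[0, 1]) f (s * c + (1 - s) * u) = F c - F u.
  move=> uab; rewrite -(integral_segment cg dF uab cab); congr (_ * _).
  by apply: eq_Rintegral => s; rewrite inE/= in_itv/= => s01; rewrite gf//; nra.
have aab : a <= a <= b by lra.
have bab : a <= b <= b by lra.
have Ea := E a aab; have Eb := E b bab.
move: Ea Eb; set Ia := \int[mu]_(s in _) _; set Ib := \int[mu]_(s in _) _.
have -> : c - a = (1 - al) * (b - a) by rewrite /c; ring.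
have -> : c - b = - al * (b - a) by rewrite /c; ring.
move=> Ea Eb.
have -> : F b - F a = (F c - F a) - (F c - F b) by ring.
by rewrite -Ea -Eb; ring.
Qed.
End total_error.

Theorem theorem11 (R : realType) (I J : set R) (h f : R -> R)
    (a b alpha lambda p q : R)
    (hI : is_interval I) (hJ : is_interval J) (h01J : `]0, 1[ `<=` J)
    (h_ge0 : forall t, J t -> 0 <= h t)
    (h_neq0 : exists2 t, J t & h t != 0)
    (h_L1 : L1_on 0 1 h)
    (f_diff : forall x : R, (interior I) x -> derivable f x 1)
    (ha : (interior I) a) (hb : (interior I) b) (hab : a < b)
    (df_L1 : L1_on a b (derive1 f))
    (halpha : 0 <= alpha <= 1) (hlambda : 0 <= lambda <= 1)
    (hq : 1 < q) (hpq : 1 / p + 1 / q = 1)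
    (hconv : h_convex h `[a, b] (fun x => `|derive1 f x| `^ q)) :
  let C := (1 - alpha) *
    (`|derive1 f ((1 - alpha) * b + alpha * a)| `^ q + `|derive1 f a| `^ q) in
  let D := alpha *
    (`|derive1 f ((1 - alpha) * b + alpha * a)| `^ q + `|derive1 f b| `^ q) in
  let eps1 := (alpha * lambda) `^ (p + 1)
    + (1 - alpha - alpha * lambda) `^ (p + 1) in
  let eps2 := (alpha * lambda) `^ (p + 1)
    - (alpha * lambda - 1 + alpha) `^ (p + 1) in
  let eps3 := (lambda * (1 - alpha)) `^ (p + 1)
    + (alpha - lambda * (1 - alpha)) `^ (p + 1) in
  let eps4 := (lambda * (1 - alpha)) `^ (p + 1)
    - (lambda * (1 - alpha) - alpha) `^ (p + 1) in
  let lhs := `| lambda * (alpha * f a + (1 - alpha) * f b)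
      + (1 - lambda) * f (alpha * a + (1 - alpha) * b)
      - 1 / (b - a) * Lint a b f | in
  let K := (b - a) * (1 / (p + 1)) `^ (1 / p) * (Lint 0 1 h) `^ (1 / q) in
  [/\ alpha * lambda <= 1 - alpha <= 1 - lambda * (1 - alpha) ->
        lhs <= K * (eps1 `^ (1 / p) * C `^ (1 / q)
                    + eps3 `^ (1 / p) * D `^ (1 / q)),
      alpha * lambda <= 1 - lambda * (1 - alpha) <= 1 - alpha ->
        lhs <= K * (eps1 `^ (1 / p) * C `^ (1 / q)
                    + eps4 `^ (1 / p) * D `^ (1 / q))
    & 1 - alpha <= alpha * lambda <= 1 - lambda * (1 - alpha) ->
        lhs <= K * (eps2 `^ (1 / p) * C `^ (1 / q)
                    + eps3 `^ (1 / p) * D `^ (1 / q))].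
Proof.
have q0 : 0 < q by apply: lt_trans hq.
have pq : p^-1 + q^-1 = 1 by move: hpq; rewrite !div1r.
have p0 : 0 < p.
  by rewrite -invr_gt0; have := invf_lt1 q0; rewrite hq; lra.
have h0 t : 0 < t < 1 -> 0 <= h t.
  by move=> t01; apply/h_ge0/h01J; rewrite /= in_itv.
have df x : a <= x <= b -> derivable f x 1.
  by move=> xab; apply/f_diff/(interior_itvcc hI ha hb).
have cf x : a <= x <= b -> {for x, continuous f}.
  by move=> /df; exact: derivable_continuous.
set g := fun x => `|derive1 f x| `^ q in hconv *.
have ba0 : 0 < b - a by rewrite subr_gt0.
pose c := alpha * a + (1 - alpha) * b.
have cab : a <= c <= b by rewrite /c; nra.
have aab : a <= a <= b by lra.
have bab : a <= b <= b by lra.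
rewrite (addrC ((1 - alpha) * b)) -/c /=.
move=> {hI hJ h01J h_ge0 h_neq0 f_diff ha hb df_L1}.
have w1 : 0 <= 1 - alpha by lra.
have w2 : 0 <= alpha by lra.
have [l0 l1] := andP hlambda.
have m10 : 0 <= alpha * lambda by rewrite mulr_ge0.
have m20 : 0 <= lambda * (1 - alpha) by rewrite mulr_ge0.
have d1 : `|c - a| = (1 - alpha) * (b - a).
  by rewrite /c ger0_norm; nra.
have d2 : `|c - b| = alpha * (b - a).
  by rewrite distrC /c ger0_norm; nra.
(* The segments from [a] to [c] and from [b] to [c] have shares [1 - alpha] and [alpha]; the shifts
   are the weights of [f a] and [f b]. *)
have S1 := weighted_segment_h_convex (alpha * lambda) p0 q0 pq h0 h_L1 df hconv
  aab cab w1 (ltW ba0) d1.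
have S2 := weighted_segment_h_convex (lambda * (1 - alpha)) p0 q0 pq h0 h_L1
  df hconv bab cab w2 (ltW ba0) d2.
have LE := Lint_segments hab halpha cf.
rewrite -/c in LE.
set K := (b - a) * _ * _ in S1 S2 *.
set X := `| _ |.
(* The two contributions to the coefficient of [f c] add up to [1 - lambda], so the triangle
   inequality applies to the sum of both halves. *)
have XE : X <= K *
    (((1 - alpha - alpha * lambda) * `|1 - alpha - alpha * lambda| `^ p
      + alpha * lambda * `|alpha * lambda| `^ p) `^ (1 / p)
      * ((1 - alpha) * (g c + g a)) `^ (1 / q) +
     ((alpha - lambda * (1 - alpha)) * `|alpha - lambda * (1 - alpha)| `^ p
      + lambda * (1 - alpha) * `|lambda * (1 - alpha)| `^ p) `^ (1 / p)
      * (alpha * (g c + g b)) `^ (1 / q)).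
  rewrite mulrDr; apply: le_trans (lerD S1 S2).
  apply: le_trans (ler_normD _ _); rewrite /X LE le_eqVlt; apply/orP; left; apply/eqP.
  congr `| _ |.
  move: (\int[_]_(s in _) _) (\int[_]_(s in _) _) => I1 I2.
  by field; rewrite gt_eqF.
(* The zero of the kernel lies inside the segment when [m <= w], giving [eps1] and [eps3], and
   beyond it when [w <= m], giving [eps2] and [eps4]. *)
have pos m w : 0 <= m -> m <= w ->
    (w - m) * `|w - m| `^ p + m * `|m| `^ p = m `^ (p + 1) + (w - m) `^ (p + 1).
  by move=> m0 mw; rewrite !normr_powRS ?subr_ge0// addrC.
have neg m w : 0 <= m -> w <= m ->
    (w - m) * `|w - m| `^ p + m * `|m| `^ p = m `^ (p + 1) - (m - w) `^ (p + 1).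
  move=> m0 mw; rewrite -opprB normrN mulNr !normr_powRS ?subr_ge0//.
  by rewrite addrC.
split=> /andP[le1 le2]; apply: le_trans XE _;
  rewrite le_eqVlt; apply/orP; left; apply/eqP.
- have le3 : lambda * (1 - alpha) <= alpha by clear -le2; lra.
  by rewrite (pos _ _ m10 le1) (pos _ _ m20 le3).
- have le3 : alpha <= lambda * (1 - alpha) by clear -le2; lra.
  have le4 : alpha * lambda <= 1 - alpha by apply: le_trans le2.
  by rewrite (pos _ _ m10 le4) (neg _ _ m20 le3).
- have le3 : lambda * (1 - alpha) <= alpha.
    by clear -le1 le2; lra.
  rewrite (neg _ _ m10 le1) (pos _ _ m20 le3).
  by have -> : alpha * lambda - 1 + alpha = alpha * lambda - (1 - alpha) by ring.
Qed.
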